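(* Let $(Q,B,\mu)$ be a measure space with a non-trivial atomless $\sigma$-finite measure $\mu$, let $0<a<b<1$, and let $\psi:(a,b)\to(0,\infty)$ be continuous with $\inf_{p\in(a,b)}\psi(p)>0$. Then the dual space of $G\psi_{a,b}$ is degenerate: $[G\psi_{a,b}]^*=\{0\}$. Consequently the associate space $[G\psi_{a,b}]'$ is also degenerate, i.e. equals $\{0\}$.
   Context: For $p>0$, $\|f\|_p=\left(\int_Q|f|^p\,d\mu\right)^{1/p}$. $G\psi_{a,b}$ is the space of measurable $f:Q\to\mathbb R$ (modulo $\mu$-a.e. equality) with quasi-norm $\|f\|_{G\psi_{a,b}}:=\sup_{p\in(a,b)}\|f\|_p/\psi(p)<\infty$. The dual space $[G\psi_{a,b}]^*$ is the space of linear functionals on $G\psi_{a,b}$ that are continuous with respect to the topology induced by this quasi-norm. The associate space $[G\psi_{a,b}]'$ is the set of measurable $g$ with $\int_Q|fg|\,d\mu<\infty$ for all $f\in G\psi_{a,b}$. *)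

(* Defs.v *)
From HB Require Import structures.
From mathcomp Require Import all_boot all_order all_algebra.
From mathcomp Require Import all_classical all_reals all_analysis.
Set Implicit Arguments. Unset Strict Implicit. Unset Printing Implicit Defensive.
Import Order.TTheory GRing.Theory Num.Theory.
Local Open Scope classical_set_scope.
Local Open Scope ring_scope.

Definition atomless {d} {T : measurableType d} {R : realType}
  (mu : {measure set T -> \bar R}) : Prop :=
  forall A : set T, measurable A -> (0 < mu A)%E ->
    exists B : set T, [/\ measurable B, B `<=` A, (0 < mu B)%E & (mu B < mu A)%E].

Definition Gnorm {d} {T : measurableType d} {R : realType}
  (mu : {measure set T -> \bar R}) (psi : R -> R) (a b : R) (f : T -> R) : \bar R :=
  ereal_sup [set ('N[mu]_(p%:E)[EFin \o f] * ((psi p)^-1)%R%:E)%E | p in `]a, b[%classic].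

(* Membership in G psi_{a,b} (for a representative of an a.e.-class). *)
Definition inG {d} {T : measurableType d} {R : realType}
  (mu : {measure set T -> \bar R}) (psi : R -> R) (a b : R) (f : T -> R) : Prop :=
  measurable_fun setT f /\ (Gnorm mu psi a b f < +oo)%E.

(* Elements of the dual space [G psi_{a,b}]^*, represented as maps L on
   representatives which are well defined on a.e.-classes, linear, and
   continuous for the topology induced by the quasi-norm. *)
Definition in_dual {d} {T : measurableType d} {R : realType}
  (mu : {measure set T -> \bar R}) (psi : R -> R) (a b : R)
  (L : (T -> R) -> R) : Prop :=
  [/\ (forall f g, inG mu psi a b f -> inG mu psi a b g ->
         {ae mu, forall x, f x = g x} -> L f = L g),
      (forall f g, inG mu psi a b f -> inG mu psi a b g -> L (f \+ g) = L f + L g),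
      (forall (c : R) f, inG mu psi a b f -> L (fun x => c * f x) = c * L f)
    & (forall f, inG mu psi a b f -> forall e : R, 0 < e ->
         exists2 delta : R, 0 < delta & forall g, inG mu psi a b g ->
           (Gnorm mu psi a b (fun x => (g x - f x)%R) < delta%:E)%E -> `|L g - L f| < e)].

Definition in_assoc {d} {T : measurableType d} {R : realType}
  (mu : {measure set T -> \bar R}) (psi : R -> R) (a b : R) (g : T -> R) : Prop :=
  measurable_fun setT g /\
  forall f, inG mu psi a b f -> (\int[mu]_x `|f x * g x|%:E < +oo)%E.

(* Main.v *)
(* For p < 1, splitting f into n pieces f 1_{A_i} of equal distribution divides
   the integral of |f|^p by n, so n f 1_{A_i} has quasi-norm about
   n^(1 - 1/p) |f|_p, uniformly small for p < b < 1; as f is the average of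
   these functions, a continuous functional vanishes at f.  One partition serves
   all exponents p at once: it suffices that the A_i halve, repeatedly, every
   level set {r <= |f| <= 2 r} of a countable family covering the space, which
   costs only a factor 2 in the quasi-norm.
   If |g| >= e on a set E of positive finite measure, cut E into disjoint sets
   A_k of measure 2^-(k+1) mu E and let f = 2^k on A_k: then f lies in the
   space because 2^p / 2 <= 2^b / 2 < 1, but each A_k contributes at least
   e mu E / 2 to the integral of |f g|. *)
Require Import Defs.
From HB Require Import structures.
From mathcomp Require Import all_boot all_order all_algebra.
From mathcomp Require Import all_classical all_reals all_analysis.
From mathcomp Require Import measurable_realfun lra ring.
Import Order.TTheory GRing.Theory Num.Theory numFieldNormedType.Exports.
Local Open Scope classical_set_scope.
Local Open Scope ring_scope.

(** * Subsets of prescribed measure in an atomless space *)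

Lemma measure_subset_fine {d} {T : measurableType d} {R : realType}
  (mu : {measure set T -> \bar R}) (A E : set T) :
  measurable A -> measurable E -> (mu E < +oo)%E -> A `<=` E ->
  mu A = (fine (mu A))%:E.
Proof.
move=> mA mE Ey AE; rewrite fineK// ge0_fin_numE//.
by apply: le_lt_trans Ey; apply: le_measure; rewrite ?inE.
Qed.

(** An atomless set of positive measure splits properly, and the smaller part has at most half the
    measure; iterate. *)
Lemma atomless_small {d} {T : measurableType d} {R : realType}
  (mu : {measure set T -> \bar R}) (E : set T) (e : R) :
  atomless mu -> measurable E -> (0 < mu E)%E -> (mu E < +oo)%E -> 0 < e ->
  exists B, [/\ measurable B, B `<=` E, (0 < mu B)%E & (mu B <= e%:E)%E].
Proof.
move=> atl mE E0 Ey e0.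
have small n : exists B, [/\ measurable B, B `<=` E, (0 < mu B)%E &
    2 ^+ n * fine (mu B) <= fine (mu E)].
  elim: n => [|n [B [mB BE B0 Bn]]]; first by exists E; split => //; rewrite expr0 mul1r.
  have [C [mC CB C0 CltB]] := atl B mB B0.
  have CE := subset_trans CB BE.
  have mD := measurableD mB mC.
  have DE : B `\` C `<=` E by move=> x [/BE].
  have BCD : mu B = (mu C + mu (B `\` C))%E.
    by rewrite -{1}(setDUK CB) measureU// setDIK.
  move: BCD C0 CltB.
  rewrite (measure_subset_fine mu B E)// (measure_subset_fine mu C E)//.
  rewrite (measure_subset_fine mu (B `\` C) E)// -EFinD !lte_fin => -[BCD] C0 CltB.
  have [le_CD|/ltW le_DC] := leP (fine (mu C)) (fine (mu (B `\` C))).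
  - exists C; split => //.
      by rewrite (measure_subset_fine mu C E)// lte_fin.
    apply: le_trans Bn; rewrite exprSr -mulrA ler_wpM2l ?exprn_ge0//; lra.
  - exists (B `\` C); split => //.
      rewrite (measure_subset_fine mu _ E)// lte_fin; lra.
    apply: le_trans Bn; rewrite exprSr -mulrA ler_wpM2l ?exprn_ge0//; lra.
(* It suffices that [2 ^+ n] exceeds [mu E / e], and already [n] does. *)
pose n := Num.bound (fine (mu E) / e).
have [B [mB BE B0 Bn]] := small n.
exists B; split => //; rewrite (measure_subset_fine mu B E)// lee_fin.
have nE : fine (mu E) <= 2 ^+ n * e.
  rewrite -ler_pdivrMr// ltW// (@lt_trans _ _ n%:R)//.
    by apply: archi_boundP; rewrite divr_ge0 ?fine_ge0// ltW.
  by rewrite -natrX ltr_nat ltn_expl.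
by rewrite -(ler_pM2l (exprn_gt0 n (ltr0n R 2)))// (le_trans Bn).
Qed.

(** Sierpinski's intermediate value theorem, by greedy exhaustion: grow sets of measure at most [c],
    each step gaining at least half of the possible gain. If their union fell short of [c], a small
    leftover piece would have been available at every stage, although the gains tend to 0. *)
Lemma atomless_intermediate {d} {T : measurableType d} {R : realType}
  (mu : {measure set T -> \bar R}) (E : set T) (c : R) :
  atomless mu -> measurable E -> (mu E < +oo)%E -> 0 <= c -> (c%:E <= mu E)%E ->
  exists B, [/\ measurable B, B `<=` E & mu B = c%:E].
Proof.
move=> atl mE Ey c0 cE.
pose m A := fine (mu A).
have muE A : measurable A -> A `<=` E -> mu A = (m A)%:E.
  by move=> mA AE; exact: measure_subset_fine Ey AE.
have le_m A B : measurable A -> measurable B -> B `<=` E -> A `<=` B -> m A <= m B.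
  move=> mA mB BE AB; rewrite -lee_fin -!muE//; last exact: subset_trans BE.
  by apply: le_measure; rewrite ?inE.
pose ok A := [/\ measurable A, A `<=` E & m A <= c].
(* Greedy step: A' gains at least half of what any admissible extension of A
   could gain. *)
have step A : exists A', ok A -> [/\ ok A', A `<=` A' & forall C, ok C -> A `<=` C ->
    m C + m A <= 2 * m A'].
  have [okA|] := pselect (ok A); last by exists A.
  have [mA AE Ac] := okA.
  pose S := [set m C | C in [set C | ok C /\ A `<=` C]].
  have supS : has_sup S.
    split; first by exists (m A), A => //; split => //; exact: subset_refl.
    by exists c => _ [C [[_ _ ?] _] <-].
  have [le_sA|lt_As] := leP (sup S) (m A).
    exists A => _; split => // C okC AC.
    have : m C <= sup S by apply: ub_le_sup; [exact: supS.2|exists C].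
    lra.
  have e0 : 0 < (sup S - m A) / 2 by lra.
  have [_ [B [okB AB] <-] hB] := sup_adherent e0 supS.
  exists B => _; split => // C okC AC.
  have : m C <= sup S by apply: ub_le_sup; [exact: supS.2|exists C].
  lra.
have [g gP] := choice step.
pose B n := iter n g set0.
have okB n : ok (B n).
  elim: n => [|n IH]; last by have [] := gP _ IH.
  by split => //=; rewrite /m measure0.
have mB n : measurable (B n) by have [] := okB n.
have BE n : B n `<=` E by have [] := okB n.
have ndB : nondecreasing_seq B.
  apply/nondecreasing_seqP => n; apply/subsetPset.
  by have [] := gP _ (okB n).
pose U := \bigcup_n B n.
have mU : measurable U by exact: bigcup_measurable.
have UE : U `<=` E by apply: bigcup_sub => n _; exact: BE.
have cvgB : m \o B @ \oo --> m U.
  apply: fine_cvg; rewrite fineK; last by rewrite muE.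
  exact: nondecreasing_cvg_mu.
have Uc : m U <= c.
  rewrite -(cvg_lim (@Rhausdorff R) cvgB).
  apply: limr_le; first by apply/cvg_ex; exists (m U).
  by apply: nearW => n; have [] := okB n.
exists U; split => //; rewrite muE//; congr EFin; apply/eqP; rewrite eq_le Uc /=.
rewrite leNgt; apply/negP => ltUc.
have mD : measurable (E `\` U) by exact: measurableD.
have DE : E `\` U `<=` E by exact: subDsetl.
have EUD : m E = m U + m (E `\` U).
  apply: EFin_inj; rewrite EFinD -!muE// -{1}(setDUK UE) measureU//.
  by rewrite setDIK.
have cE' : c <= m E by rewrite -lee_fin -muE.
have D0 : (0 < mu (E `\` U))%E by rewrite muE// lte_fin; lra.
have Dy : (mu (E `\` U) < +oo)%E by rewrite muE// ltry.
have e0 : 0 < c - m U by lra.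
have [C [mC CD C0 Ce]] := atomless_small mu _ _ atl mD D0 Dy e0.
have CE := subset_trans CD DE.
have UCE : U `|` C `<=` E by rewrite subUset.
have UC : m (U `|` C) = m U + m C.
  apply: EFin_inj; rewrite EFinD -!muE//; last exact: measurableU.
  rewrite measureU//; apply/seteqP; split => // x [Ux /CD[_]]; exact.
move: C0 Ce; rewrite muE// lte_fin lee_fin => C0 Ce.
have okUC : ok (U `|` C) by split => //; [exact: measurableU|rewrite UC; lra].
(* [U] with [C] added competes at every stage of the greedy choice. In the limit [m (B n)] becomes
   [m U], which contradicts [0 < m C]. *)
have bnd n : m U + m C + m (B n) <= 2 * m U.
  have [_ _ /(_ _ okUC)] := gP _ (okB n).
  rewrite UC => h; apply: le_trans (h _) _.
    by move=> x Bx; left; exists n.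
  rewrite ler_pM2l//; apply: le_m => //; first exact: (mB n.+1).
  by move=> x Bx; exists n.+1.
have : m U <= m U - m C.
  rewrite -{1}(cvg_lim (@Rhausdorff R) cvgB).
  apply: limr_le; first by apply/cvg_ex; exists (m U).
  by apply: nearW => n /=; have := bnd n; lra.
lra.
Qed.

Lemma atomless_halving {d} {T : measurableType d} {R : realType}
  (mu : {measure set T -> \bar R}) (E : set T) :
  atomless mu -> measurable E -> (mu E < +oo)%E ->
  exists B, [/\ measurable B, B `<=` E, mu B = (2^-1%:E * mu E)%E &
    mu (E `\` B) = (2^-1%:E * mu E)%E].
Proof.
move=> atl mE Ey.
have EE : mu E = (fine (mu E))%:E by exact: measure_subset_fine Ey _.
have m0 : 0 <= fine (mu E) by rewrite fine_ge0.
have [||B [mB BE Bh]] := atomless_intermediate mu E (2^-1 * fine (mu E)) atl mE Ey.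
- by rewrite mulr_ge0.
- by rewrite EE lee_fin; lra.
exists B; split => //; first by rewrite Bh EFinM -EE.
rewrite measureD// setIidr//.
transitivity ((fine (mu E))%:E - (2^-1 * fine (mu E))%:E)%E.
  by congr (_ - _)%E.
rewrite EE -EFinB -EFinM/=; congr EFin; lra.
Qed.

(** Each [A] within [E n] is halved separately and the halves are united; since the [E n] are
    disjoint, the union meets [E n] in its own half only. *)
Lemma atomless_halving_seq {d} {T : measurableType d} {R : realType}
  (mu : {measure set T -> \bar R}) (E : (set T)^nat) (A : set T) :
  atomless mu -> (forall n, measurable (E n)) -> trivIset setT E ->
  measurable A ->
  exists B, [/\ measurable B, B `<=` A & forall n, (mu (E n) < +oo)%E ->
    mu (B `&` E n) = (2^-1%:E * mu (A `&` E n))%E /\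
    mu ((A `\` B) `&` E n) = (2^-1%:E * mu (A `&` E n))%E].
Proof.
move=> atl mE tE mA.
have halve n : exists B, [/\ measurable B, B `<=` A `&` E n &
    (mu (E n) < +oo)%E -> mu B = (2^-1%:E * mu (A `&` E n))%E /\
    mu ((A `&` E n) `\` B) = (2^-1%:E * mu (A `&` E n))%E].
  have mAE : measurable (A `&` E n) by exact: measurableI.
  have [fin|] := pselect (mu (A `&` E n) < +oo)%E.
    by have [B [? ? ? ?]] := atomless_halving mu _ atl mAE fin; exists B.
  (* Nothing is claimed when [E n] has infinite measure, so the empty set serves here. *)
  move=> inf; exists set0; split => // fin; case: inf.
  by apply: le_lt_trans fin; apply: le_measure; rewrite ?inE.
have [B BP] := choice halve.
have mB n : measurable (B n) by have [] := BP n.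
have BAE n : B n `<=` A `&` E n by have [] := BP n.
have BE n : \bigcup_k B k `&` E n = B n.
  apply/seteqP; split => [x [[k _ Bk] En]|x Bn]; last first.
    by split; [exists n|have [] := BAE n x Bn].
  suff -> : n = k by [].
  by apply: tE => //; exists x; split => //; have [] := BAE k x Bk.
exists (\bigcup_k B k); split => [||n fin].
- exact: bigcup_measurable.
- by apply: bigcup_sub => n _ x /BAE[].
- have [_ _ /(_ fin)[h1 h2]] := BP n.
  rewrite BE; split => //; rewrite -h2; congr (mu _).
  apply/seteqP; split => x /=.
    by move=> [[Ax nB] En]; split => // Bn; apply: nB; exists n.
  move=> [[Ax En] nB]; split => //; split => // UB; apply: nB.
  by rewrite -BE.
Qed.

(** * Level sets and quasi-norm estimates for cut functions *)

Lemma measurable_level_cover {d} {T : measurableType d} {R : realType}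
  (f : T -> R) : measurable_fun setT f ->
  exists (r : nat -> R) (E : (set T)^nat),
    [/\ forall n, 0 <= r n, forall n, measurable (E n), trivIset setT E,
        \bigcup_n E n = setT & forall n x, E n x -> r n <= `|f x| <= 2 * r n].
Proof.
move=> mf.
(* The levels are the absolute values of all rationals, with default 0 at indices coding none. A
   nonzero value [f x] lies in the band of any rational strictly between half of [|f x|] and
   [|f x|]; zeros lie in the band of level 0. *)
pose r n : R := `|ratr (odflt 0 (unpickle n : option rat))|.
pose F n := [set x | r n <= `|f x| <= 2 * r n].
have mF n : measurable (F n).
  have -> : F n = setT `&` (fun x => `|f x|) @^-1` `[r n, 2 * r n]%classic.
    by rewrite setTI; apply/seteqP; split => x /=; rewrite in_itv.
  exact: (measurableT_comp (@normr_measurable R setT) mf).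
exists r, (seqDU F); split => //.
- by move=> n; exact: normr_ge0.
- by move=> n; apply: measurableD => //; apply: bigsetU_measurable.
- rewrite -seqDU_bigcup_eq; apply/seteqP; split => // x _.
  have [q Hq] : exists q : rat, `|ratr q : R| <= `|f x| <= 2 * `|ratr q|.
    have [->|fx0] := eqVneq (f x) 0.
      by exists 0; rewrite rmorph0 !normr0 mulr0 lexx.
    have fx : 0 < `|f x| by rewrite normr_gt0.
    have [|q] := @rat_in_itvoo R (`|f x| / 2) (`|f x|); first lra.
    rewrite in_itv/= => /andP[h1 h2]; exists q.
    have q0 : 0 < ratr q :> R by lra.
    by rewrite (gtr0_norm q0); apply/andP; split; lra.
  by exists (pickle q) => //; rewrite /F/= /r pickleK.
- by move=> n x [].
Qed.

Lemma LnormE {d} {T : measurableType d} {R : realType}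
  (mu : {measure set T -> \bar R}) (p : R) (f : T -> R) :
  ('N[mu]_(p%:E)[EFin \o f] = (\int[mu]_x (`|f x| `^ p)%:E) `^ p^-1)%E.
Proof. by rewrite unlock. Qed.

Lemma Gnorm_le {d} {T : measurableType d} {R : realType}
  (mu : {measure set T -> \bar R}) (psi : R -> R) (a b k : R) (f g : T -> R) :
  0 < a -> (forall p, a < p < b -> 0 < psi p) -> 0 <= k ->
  (forall p, a < p < b -> (\int[mu]_x (`|g x| `^ p)%:E <=
     (k `^ p)%:E * \int[mu]_x (`|f x| `^ p)%:E)%E) ->
  (Gnorm mu psi a b g <= k%:E * Gnorm mu psi a b f)%E.
Proof.
move=> a0 psi0 k0 h; apply: ge_ereal_sup => _ /= [p + <-].
rewrite in_itv/= => pab.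
have p0 : 0 < p by case/andP: pab => /(lt_trans a0).
have int0 (u : T -> R) : (0 <= \int[mu]_x (`|u x| `^ p)%:E)%E.
  by apply: integral_ge0 => x _; rewrite lee_fin powR_ge0.
have ipsi : (0 <= (psi p)^-1%:E :> \bar R)%E by rewrite lee_fin invr_ge0 ltW// psi0.
apply: (@le_trans _ _ (k%:E * ('N[mu]_(p%:E)[EFin \o f] * (psi p)^-1%:E))%E); last first.
  by apply: lee_wpmul2l; [rewrite lee_fin|apply: ereal_sup_ubound; exists p; rewrite //= in_itv].
rewrite muleA; apply: lee_wpmul2r => //.
rewrite !LnormE.
have -> : k%:E = ((k `^ p)%:E `^ p^-1)%E :> \bar R.
  by rewrite poweR_EFin -powRrM mulfV ?gt_eqF// powRr1.
rewrite -poweRM ?lee_fin ?powR_ge0//.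
apply: gt0_ler_poweR; first by rewrite invr_ge0 ltW.
- by rewrite in_itv/= int0 leey.
- by rewrite in_itv/= mule_ge0 ?lee_fin ?powR_ge0// leey.
- exact: h.
Qed.

Lemma inG_int_lty {d} {T : measurableType d} {R : realType}
  (mu : {measure set T -> \bar R}) (psi : R -> R) (a b p : R) (f : T -> R) :
  0 < a -> (forall p, a < p < b -> 0 < psi p) -> a < p < b ->
  inG mu psi a b f -> (\int[mu]_x (`|f x| `^ p)%:E < +oo)%E.
Proof.
move=> a0 psi0 pab [mf fG].
have p0 : 0 < p by case/andP: pab => /(lt_trans a0).
have : ('N[mu]_(p%:E)[EFin \o f] * (psi p)^-1%:E < +oo)%E.
  by apply: le_lt_trans fG; apply: ereal_sup_ubound; exists p; rewrite //= in_itv.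
rewrite LnormE.
set I := (\int[mu]_x _)%E => h.
have : (I `^ p^-1 < +oo)%E.
  rewrite ltNge leye_eq; apply/eqP => e; move: h.
  by rewrite e gt0_mulye ?ltxx// lte_fin invr_gt0 psi0.
by apply: lty_poweRy; rewrite invr_neq0// gt_eqF.
Qed.

(* Level 0 is exempted because {f = 0} may have infinite measure. *)
Lemma integral_cut_le {d} {T : measurableType d} {R : realType}
  (mu : {measure set T -> \bar R}) (p c q : R) (f : T -> R) (r : nat -> R)
  (E : (set T)^nat) (A : set T) :
  0 < p -> 0 <= q -> measurable_fun setT f ->
  (forall n, 0 <= r n) -> (forall n, measurable (E n)) -> trivIset setT E ->
  \bigcup_n E n = setT -> (forall n x, E n x -> r n <= `|f x| <= 2 * r n) ->
  measurable A ->
  (forall n, r n != 0 -> (mu (A `&` E n) <= q%:E * mu (E n))%E) ->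
  (\int[mu]_x (`|c * (f \_ A) x| `^ p)%:E <=
     ((`|c| * 2) `^ p * q)%:E * \int[mu]_x (`|f x| `^ p)%:E)%E.
Proof.
move=> p0 q0 mf r0 mE tE UE rE mA hA.
have mp (u : T -> R) : measurable_fun setT u ->
    measurable_fun setT (fun x => (`|u x| `^ p)%:E).
  move=> mu'; apply/measurable_EFinP.
  apply: (measurableT_comp (measurable_powR _)).
  exact: (measurableT_comp (@normr_measurable R setT)).
have mg : measurable_fun setT (fun x => c * (f \_ A) x).
  apply: measurable_funM => //; apply/(measurable_restrictT _ _).1 => //.
  exact: measurable_funTS.
rewrite -UE !ge0_integral_bigcup//; [|by rewrite UE; exact: mp..].
rewrite -nneseriesZl; last first.
  by move=> n _; apply: integral_ge0 => x _; rewrite lee_fin powR_ge0.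
apply: lee_nneseries => [n _ _|n _].
  by apply: integral_ge0 => x _; rewrite lee_fin powR_ge0.
have mpn (u : T -> R) : measurable_fun setT u ->
    measurable_fun (E n) (fun x => (`|u x| `^ p)%:E).
  by move=> /mp; exact: measurable_funTS.
have cp : 0 <= (`|c| * 2) `^ p by exact: powR_ge0.
have [rn0|rn0] := eqVneq (r n) 0.
  rewrite (_ : \int[mu]_(x in E n) _ = 0)%E; last first.
    apply: integral0_eq => x Ex; have := rE n x Ex.
    rewrite rn0 mulr0 normr_le0 => /andP[_ /eqP fx].
    by rewrite patchE fx; case: ifP; rewrite mulr0 normr0 powR0// gt_eqF.
  rewrite mule_ge0 ?lee_fin ?mulr_ge0//.
  by apply: integral_ge0 => x _; rewrite lee_fin powR_ge0.
(* On [E n] the upper bound [2 * r n] estimates the cut function and the lower bound [r n] estimates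
   [f]; the factor 2 is the loss between them. *)
apply: (@le_trans _ _ (((`|c| * 2 * r n) `^ p)%:E * mu (A `&` E n))%E).
  rewrite -integral_cst; last exact: measurableI.
  rewrite setIC integral_mkcondr; apply: ge0_le_integral => //.
  - exact: mpn.
  - by apply/measurable_restrict => //; exact: measurable_cst.
  - move=> x Ex; rewrite !patchE; case: ifPn => xA; last first.
      by rewrite mulr0 normr0 powR0// gt_eqF.
    rewrite lee_fin ge0_ler_powR ?nnegrE ?mulr_ge0 ?(ltW p0)//.
    by rewrite normrM -mulrA ler_wpM2l//; have /andP[] := rE n x Ex.
rewrite powRM ?mulr_ge0// EFinM [X in (_ <= X * _)%E]EFinM -!muleA.
apply: lee_wpmul2l; first by rewrite lee_fin.
apply: (@le_trans _ _ ((r n `^ p)%:E * (q%:E * mu (E n)))%E).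
  by apply: lee_wpmul2l; [rewrite lee_fin powR_ge0|exact: hA].
rewrite muleCA; apply: lee_wpmul2l; first by rewrite lee_fin.
rewrite -integral_cst//; apply: ge0_le_integral => //.
- by move=> x _; rewrite lee_fin powR_ge0.
- exact: mpn.
- move=> x Ex; rewrite lee_fin ge0_ler_powR ?nnegrE ?(ltW p0)//.
  by have /andP[] := rE n x Ex.
Qed.

Lemma level_measure_lty {d} {T : measurableType d} {R : realType}
  (mu : {measure set T -> \bar R}) (p r : R) (f : T -> R) (E : set T) :
  0 < p -> 0 < r -> measurable_fun setT f -> measurable E ->
  (forall x, E x -> r <= `|f x|) ->
  (\int[mu]_x (`|f x| `^ p)%:E < +oo)%E -> (mu E < +oo)%E.
Proof.
move=> p0 r0 mf mE rE fin.
have mfp : measurable_fun setT (fun x => (`|f x| `^ p)%:E).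
  apply/measurable_EFinP; apply: (measurableT_comp (measurable_powR _)).
  exact: (measurableT_comp (@normr_measurable R setT)).
have fp0 x : (0 <= (`|f x| `^ p)%:E)%E by rewrite lee_fin powR_ge0.
have : ((r `^ p)%:E * mu E < +oo)%E.
  apply: le_lt_trans fin; rewrite -(integral_cst mu mE).
  apply: (@le_trans _ _ (\int[mu]_(x in E) (`|f x| `^ p)%:E)%E); last first.
    exact: ge0_subset_integral.
  apply: ge0_le_integral => //.
  - by move=> x _; rewrite lee_fin powR_ge0.
  - exact: measurable_funTS.
  - move=> x Ex; rewrite lee_fin ge0_ler_powR ?nnegrE ?(ltW p0) ?(ltW r0)//.
    exact: rE.
rewrite !ltNge !leye_eq; apply: contra => /eqP ->.
by rewrite gt0_muley// lte_fin powR_gt0.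
Qed.

(** Makes the gain uniform in the exponent: as [q <= 1] and [p < b], one has [q <= q]^ (p /
    b)[, so the single factor]q [^ b^-1] serves for all [p]. *)
Lemma Gnorm_cut {d} {T : measurableType d} {R : realType}
  (mu : {measure set T -> \bar R}) (psi : R -> R) (a b c q : R) (f : T -> R)
  (r : nat -> R) (E : (set T)^nat) (A : set T) :
  0 < a -> (forall p, a < p < b -> 0 < psi p) -> 0 < q <= 1 ->
  inG mu psi a b f ->
  (forall n, 0 <= r n) -> (forall n, measurable (E n)) -> trivIset setT E ->
  \bigcup_n E n = setT -> (forall n x, E n x -> r n <= `|f x| <= 2 * r n) ->
  measurable A ->
  (forall n, r n != 0 -> (mu (A `&` E n) <= q%:E * mu (E n))%E) ->
  inG mu psi a b (fun x => c * (f \_ A) x) /\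
  (Gnorm mu psi a b (fun x => (c * (f \_ A) x)%R) <=
    (`|c| * 2 * q `^ b^-1)%:E * Gnorm mu psi a b f)%E.
Proof.
move=> a0 psi0 q01 [mf fG] r0 mE tE UE rE mA hA.
have q0 : 0 <= q by case/andP: q01 => /ltW.
have le_norm : (Gnorm mu psi a b (fun x => (c * (f \_ A) x)%R) <=
    (`|c| * 2 * q `^ b^-1)%:E * Gnorm mu psi a b f)%E.
  apply: Gnorm_le => // [|p /andP[ap pb]]; first by rewrite !mulr_ge0 ?powR_ge0.
  have p0 := lt_trans a0 ap.
  apply: le_trans.
    exact: (integral_cut_le mu p c q f r E A p0 q0 mf r0 mE tE UE rE mA hA).
  apply: lee_wpmul2r.
    by apply: integral_ge0 => x _; rewrite lee_fin powR_ge0.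
  rewrite lee_fin [leRHS]powRM ?mulr_ge0 ?powR_ge0//.
  rewrite ler_wpM2l ?powR_ge0// -powRrM ger1_powR//.
  by rewrite ler_pdivrMl ?mulr1 ?ltW// (lt_trans p0).
split => //; split.
  apply: measurable_funM => //; apply/(measurable_restrictT _ _).1 => //.
  exact: measurable_funTS.
apply: le_lt_trans le_norm _.
have : (Gnorm mu psi a b f < +oo)%E := fG.
case: (Gnorm mu psi a b f) => [s _|//|_]; first by rewrite -EFinM ltry.
(* The remaining value is -oo, the supremum over an empty interval of exponents. *)
have [->|k0] := eqVneq (`|c| * 2 * q `^ b^-1) 0; first by rewrite mul0e ltry.
by rewrite gt0_muleNy// lte_fin lt_neqAle eq_sym k0 !mulr_ge0 ?powR_ge0.
Qed.

(** * Vanishing of continuous linear functionals *)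

Lemma exprn_powR {R : realType} (x y : R) n :
  0 <= x -> (x ^+ n) `^ y = (x `^ y) ^+ n.
Proof. by move=> x0; rewrite -powR_mulrn// powRAC powR_mulrn// powR_ge0. Qed.

(** This is where [b < 1] enters: the product is 2 to the negative power [1 - 1/b]. It is the ratio
    by which the bound on a functional shrinks at each halving. *)
Lemma powR_half_lt {R : realType} (b : R) :
  0 < b -> b < 1 -> 2 * (2^-1 : R) `^ b^-1 < 1.
Proof.
move=> b0 b1; have lnh : ln (2^-1 : R) < 0 by rewrite ln_lt0//; lra.
rewrite -ltr_pdivlMl// mulr1 -[ltRHS]lnK ?posrE// /powR.
rewrite ifF ?ltr_expR; last by apply/negbTE; rewrite invr_neq0.
by rewrite gtr_nMl// invf_gt1.
Qed.

(** After [m] halvings [f] is a sum of [2 ^+ m] pieces, on each of which continuity at zero bounds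
    [L] by [K * rho ^+ m]. Hence [|L f|] is at most [K * (2 * rho) ^+ m], which tends to 0. *)
Lemma dual_eq0 {d} {T : measurableType d} {R : realType}
  (mu : {measure set T -> \bar R}) (psi : R -> R) (a b : R) (L : (T -> R) -> R)
  (f : T -> R) :
  atomless mu -> 0 < a -> a < b -> b < 1 -> (forall p, a < p < b -> 0 < psi p) ->
  in_dual mu psi a b L -> inG mu psi a b f -> L f = 0.
Proof.
move=> atl a0 ab b1 psi0 [_ LD LZ Lcont] fG.
have b0 := lt_trans a0 ab.
have [mf fGn] := fG.
have [r [E [r0 mE tE UE rE]]] := measurable_level_cover f mf.
have Efin n : r n != 0 -> (mu (E n) < +oo)%E.
  (* A single exponent, here the midpoint, shows that nonzero levels have finite measure and can be
     halved. *)
  move=> rn0; have pab : a < (a + b) / 2 < b by apply/andP; split; lra.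
  apply: (level_measure_lty mu ((a + b) / 2) (r n) f) => //; first lra.
  - by rewrite lt_neqAle eq_sym rn0 r0.
  - by move=> x /rE/andP[].
  - exact: (inG_int_lty mu psi a b _ f a0 psi0 pab fG).
have [M M0 fM] : exists2 M : R, 0 < M & (Gnorm mu psi a b f <= M%:E)%E.
  move: fGn; case: (Gnorm mu psi a b f) => [s _|//|_].
    by exists (`|s| + 1); rewrite ?ltr_wpDl// lee_fin (le_trans (ler_norm s))// lerDl.
  by exists 1; rewrite ?ltr01 ?leNye.
pose small j A := forall n, r n != 0 ->
  (mu (A `&` E n) <= ((2^-1 : R) ^+ j)%:E * mu (E n))%E.
pose rho := (2^-1 : R) `^ b^-1.
have rho0 : 0 < rho by rewrite powR_gt0.
have cut c j A : measurable A -> small j A ->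
    inG mu psi a b (fun x => c * (f \_ A) x) /\
    (Gnorm mu psi a b (fun x => (c * (f \_ A) x)%R) <= (`|c| * 2 * rho ^+ j * M)%:E)%E.
  move=> mA sA.
  have q01 : 0 < (2^-1 : R) ^+ j <= 1.
    by rewrite exprn_gt0//= exprn_ile1//; lra.
  have [? le_norm] := Gnorm_cut mu psi a b c _ f r E A a0 psi0 q01 fG r0 mE tE UE rE mA sA.
  split => //; apply: le_trans le_norm _.
  rewrite [X in (_ <= X)%E]EFinM.
  have -> : rho ^+ j = ((2^-1 : R) ^+ j) `^ b^-1.
    by rewrite exprn_powR.
  by apply: lee_wpmul2l => //; rewrite lee_fin !mulr_ge0 ?powR_ge0.
have smallT : small 0%N setT by move=> n _; rewrite setTI expr0 mul1e.
have patchT1 A : (f \_ A) = (fun x => 1 * (f \_ A) x).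
  by apply/funext => x; rewrite mul1r.
have fT : f \_ setT = f by rewrite patch_setT.
(* The zero function, written as a multiple of [f] so that homogeneity gives its image 0. *)
have zeroG : inG mu psi a b (fun x => 0 * f x).
  by have [] := cut 0 0%N setT measurableT smallT; rewrite fT.
have [delta delta0 hdelta] := Lcont _ zeroG 1 ltr01.
(* Chosen so that a piece at depth [j], scaled by [(K * rho ^+ j)^-1], has quasi-norm at most
   [delta / 2]. *)
pose K := 4 * M / delta.
have K0 : 0 < K by rewrite divr_gt0// mulr_gt0.
(* Induction on the number [m] of halvings still to be made; the depth [j] varies because both
   halves of [A] have depth [j.+1]. *)
have bound m : forall j A, measurable A -> small j A ->
    `|L (f \_ A)| <= 2 ^+ m * (K * rho ^+ (j + m)).
  elim: m => [|m IH] j A mA sA.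
    rewrite expr0 mul1r addn0.
    have rj := exprn_gt0 j rho0.
    pose c := (K * rho ^+ j)^-1.
    have Krj : 0 < K * rho ^+ j by exact: mulr_gt0.
    have c0 : 0 < c by rewrite invr_gt0.
    have [cG cn] := cut c j A mA sA.
    have [AG _] := cut 1 j A mA sA; rewrite -patchT1 in AG.
    have : `|L (fun x => c * (f \_ A) x) - L (fun x => 0 * f x)| < 1.
      apply: hdelta => //.
      have -> : (fun x => c * (f \_ A) x - 0 * f x) = (fun x => c * (f \_ A) x).
        by apply/funext => x; rewrite mul0r subr0.
      apply: le_lt_trans cn _; rewrite lte_fin gtr0_norm//.
      have -> : c * 2 * rho ^+ j * M = delta / 2.
        by rewrite /c /K; field; rewrite !gt_eqF.
      lra.
    rewrite !LZ// mul0r subr0 normrM gtr0_norm// /c mulrC ltr_pdivrMr//.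
    by rewrite mul1r => /ltW.
  have [B [mB BA hB]] := atomless_halving_seq mu E A atl mE tE mA.
  have half A' : (forall n, r n != 0 ->
      mu (A' `&` E n) = (2^-1%:E * mu (A `&` E n))%E) -> small j.+1 A'.
    move=> h n rn0; rewrite h// exprS EFinM -muleA.
    by apply: lee_wpmul2l; [rewrite lee_fin|exact: sA].
  have sB : small j.+1 B by apply: half => n /Efin /hB[].
  have sD : small j.+1 (A `\` B) by apply: half => n /Efin /hB[].
  have mD := measurableD mA mB.
  have [BG _] := cut 1 _ _ mB sB; rewrite -patchT1 in BG.
  have [DG _] := cut 1 _ _ mD sD; rewrite -patchT1 in DG.
  have -> : L (f \_ A) = L (f \_ B) + L (f \_ (A `\` B)).
    rewrite -LD//; congr L; apply/funext => x /=; rewrite !patchE in_setD.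
    have [xB|xB] := boolP (x \in B); last by rewrite andbT add0r.
    by rewrite andbF addr0 (_ : x \in A) ?inE//; apply: BA; rewrite -inE.
  rewrite (le_trans (ler_normD _ _))// exprS -mulrA mulr2n mulrDl mul1r.
  by rewrite addnS -addSn; apply: lerD; exact: IH.
have {}bound m : `|L f| <= K * (2 * rho) ^+ m.
  have := bound m 0%N setT measurableT smallT.
  by rewrite fT add0n mulrCA -exprMn.
apply/eqP; rewrite -normr_le0.
have rho1 : `|2 * rho| < 1 by rewrite gtr0_norm ?mulr_gt0//; exact: powR_half_lt.
rewrite -(cvg_lim (@Rhausdorff R) (@cvg_geometric R K _ rho1)).
apply: limr_ge; first by apply/cvg_ex; exists 0; exact: cvg_geometric.
by apply: nearW => m; exact: bound.
Qed.

(** * Unbounded test functions and the associate space *)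

Lemma measurable_step_function {d} {T : measurableType d} {R : realType}
  (A : (set T)^nat) (v : nat -> R) :
  (forall k, measurable (A k)) -> trivIset setT A ->
  exists f : T -> R, [/\ measurable_fun setT f, forall k x, A k x -> f x = v k &
    forall x, ~ (\bigcup_k A k) x -> f x = 0].
Proof.
move=> mA tA.
have value x : exists y, (forall k, A k x -> y = v k) /\
    (~ (\bigcup_k A k) x -> y = 0).
  have [[k _ Ak]|nA] := pselect ((\bigcup_k A k) x).
    exists (v k); split => [l Al|[]]; last by exists k.
    by congr v; apply: tA => //; exists x.
  by exists 0; split => // k Ak; case: nA; exists k.
have [f fP] := choice value.
exists f; split => [|k x|x]; [|exact: (fP x).1|exact: (fP x).2].
have mU : measurable (\bigcup_k A k) by exact: bigcup_measurable.
have -> : f = f \_ (\bigcup_k A k).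
  apply/funext => x; rewrite patchE; case: ifPn => // /negP xU.
  by apply: (fP x).2 => Ux; apply: xU; rewrite inE.
apply/(measurable_restrictT _ mU)/measurable_fun_bigcup => // k.
apply: (@eq_measurable_fun _ _ _ _ _ (cst (v k))); last exact: measurable_cst.
by move=> x; rewrite inE => Ak; have [/(_ k Ak)] := fP x.
Qed.

(** Keep halving [E] into nested sets [F k]; the differences of consecutive ones are disjoint and
    have the required measures. *)
Lemma atomless_geometric_partition {d} {T : measurableType d} {R : realType}
  (mu : {measure set T -> \bar R}) (E : set T) :
  atomless mu -> measurable E -> (mu E < +oo)%E ->
  exists A : (set T)^nat, [/\ forall k, measurable (A k), forall k, A k `<=` E,
    trivIset setT A & forall k, mu (A k) = (((2^-1 : R) ^+ k.+1)%:E * mu E)%E].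
Proof.
move=> atl mE Ey.
(* The conditions on [F] stay under the existential, so that [choice] yields a halving operator
   defined on all sets. *)
have halve F : exists B, measurable F /\ (mu F < +oo)%E ->
    [/\ measurable B, B `<=` F, mu B = (2^-1%:E * mu F)%E &
      mu (F `\` B) = (2^-1%:E * mu F)%E].
  have [[mF Fy]|nF] := pselect (measurable F /\ (mu F < +oo)%E).
    by have [B ?] := atomless_halving mu F atl mF Fy; exists B.
  by exists F.
have [H HP] := choice halve.
pose F k := iter k H E.
have FP k : [/\ measurable (F k), (mu (F k) < +oo)%E, F k `<=` E &
    mu (F k) = (((2^-1 : R) ^+ k)%:E * mu E)%E].
  elim: k => [|k [mF Fy FE Fk]]; first by split => //; rewrite expr0 mul1e.
  have [mH HF Hk _] := HP (F k) (conj mF Fy).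
  split => //=; last by rewrite Hk Fk muleA -EFinM -exprS.
    by apply: le_lt_trans Fy; apply: le_measure; rewrite ?inE.
  exact: subset_trans FE.
have FS k : [/\ measurable (F k.+1), F k.+1 `<=` F k &
    mu (F k `\` F k.+1) = (2^-1%:E * mu (F k))%E].
  by have [mF Fy _ _] := FP k; have [] := HP (F k) (conj mF Fy).
have ndF k l : (k <= l)%N -> F l `<=` F k.
  elim: l => [|l IH]; first by rewrite leqn0 => /eqP ->.
  rewrite leq_eqVlt => /predU1P[->//|/IH]; apply: subset_trans.
  by have [] := FS l.
exists (fun k => F k `\` F k.+1); split => [k|k x [Fk _]|k l _ _|k].
- by have [mF _ _ _] := FP k; have [mS _ _] := FS k; exact: measurableD.
- by have [_ _ FE _] := FP k; exact: FE.
- move=> [x [[Fk nFk] [Fl nFl]]].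
  have [kl|lk|//] := ltngtP k l; first by case: nFk; exact: ndF Fl.
  by case: nFl; exact: ndF Fk.
- have [_ _ ->] := FS k; have [_ _ _ ->] := FP k.
  by rewrite muleA -EFinM -exprS.
Qed.

Lemma nneseries_geometric {R : realType} (c z : R) : 0 <= c -> 0 <= z < 1 ->
  (\sum_(k <oo) (c * z ^+ k)%:E = (c / (1 - z))%:E)%E.
Proof.
move=> c0 /andP[z0 z1]; apply: cvg_lim => //; apply: cvg_EFin.
  by apply: nearW => n; rewrite sumEFin.
rewrite [X in X @ _ --> _](_ : _ = series (geometric c z)).
  by apply: cvg_geometric_series; rewrite ger0_norm.
by apply/funext => n; rewrite /= sumEFin.
Qed.

Lemma inG_geometric_step {d} {T : measurableType d} {R : realType}
  (mu : {measure set T -> \bar R}) (psi : R -> R) (a b c : R) (E : set T)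
  (A : (set T)^nat) (f : T -> R) :
  0 < a -> b < 1 -> 0 < c -> (forall p, a < p < b -> c <= psi p) ->
  (mu E < +oo)%E -> (forall k, measurable (A k)) -> trivIset setT A ->
  (forall k, mu (A k) = (((2^-1 : R) ^+ k.+1)%:E * mu E)%E) ->
  measurable_fun setT f -> (forall k x, A k x -> f x = 2 ^+ k) ->
  (forall x, ~ (\bigcup_k A k) x -> f x = 0) ->
  inG mu psi a b f.
Proof.
move=> a0 b1 c0 cpsi Ey mA tA muA mf fA f0; split => //.
have [m m0 muE] : exists2 m : R, 0 <= m & mu E = m%:E.
  by exists (fine (mu E)); rewrite ?fine_ge0// fineK// ge0_fin_numE.
pose z := (2 : R) `^ b / 2.
have z01 : 0 <= z < 1.
  rewrite divr_ge0 ?powR_ge0//= ltr_pdivrMr// mul1r.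
  by rewrite -[ltRHS]powRr1// /powR gt_eqF// ltr_expR ltr_pM2r// ln_gt0// ltr1n.
(* The summand 1 ensures [1 <= K], so that [K]^ p^-1 <= K [^ a^-1] for all [p] above [a]. *)
pose K := 1 + m / 2 / (1 - z).
have z1 : 0 < 1 - z by case/andP: z01; lra.
have K1 : 1 <= K by rewrite lerDl divr_ge0 ?divr_ge0// ltW.
have intK p : a < p < b -> (\int[mu]_x (`|f x| `^ p)%:E <= K%:E)%E.
  move=> /andP[ap pb]; have p0 := lt_trans a0 ap.
  have mU : measurable (\bigcup_k A k) by exact: bigcup_measurable.
  have -> : (\int[mu]_x (`|f x| `^ p)%:E =
             \int[mu]_(x in \bigcup_k A k) (`|f x| `^ p)%:E)%E.
    rewrite [RHS]integral_mkcond; apply: eq_integral => x _; rewrite patchE.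
    case: ifPn => // /negP xU; rewrite f0 ?normr0 ?powR0 ?gt_eqF//.
    by move=> Ux; apply: xU; rewrite inE.
  rewrite ge0_integral_bigcup//; last first.
    apply: measurable_funTS; apply/measurable_EFinP.
    apply: (measurableT_comp (measurable_powR _)).
    exact: (measurableT_comp (@normr_measurable R setT)).
  apply: (@le_trans _ _ (m / 2 / (1 - z))%:E); last by rewrite lee_fin lerDr.
  rewrite -nneseries_geometric ?(divr_ge0 m0)//; apply: lee_nneseries => [k _ _|k _].
    by apply: integral_ge0 => x _; rewrite lee_fin powR_ge0.
  have -> : (\int[mu]_(x in A k) (`|f x| `^ p)%:E =
             \int[mu]_(x in A k) (cst (((2 ^+ k) `^ p)%:E) x))%E.
    apply: eq_integral => x; rewrite inE => Ak.
    by rewrite (fA k x Ak) ger0_norm// exprn_ge0.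
  rewrite integral_cst// muA muE -!EFinM lee_fin exprn_powR// /z expr_div_n.
  have -> : (2 `^ p) ^+ k * (2^-1 ^+ k.+1 * m) = m / 2 * ((2 `^ p) ^+ k / 2 ^+ k).
    by rewrite exprS exprVn; ring.
  rewrite ler_wpM2l ?divr_ge0// ler_wpM2r ?invr_ge0 ?exprn_ge0//.
  by rewrite lerXn2r ?nnegrE ?powR_ge0// ler_powR ?ler1n// ltW.
apply: (@le_lt_trans _ _ (K `^ a^-1 / c)%:E); last by rewrite ltry.
apply: ge_ereal_sup => _ /= [p + <-]; rewrite in_itv/= => pab.
have /andP[ap pb] := pab; have p0 := lt_trans a0 ap.
rewrite LnormE EFinM; apply: lee_pmul.
- exact: poweR_ge0.
- by rewrite lee_fin invr_ge0 ltW// (lt_le_trans c0)// cpsi.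
- apply: (@le_trans _ _ (K%:E `^ p^-1)%E).
    apply: gt0_ler_poweR; first by rewrite invr_ge0 ltW.
    + rewrite in_itv/= leey andbT.
      by apply: integral_ge0 => x _; rewrite lee_fin powR_ge0.
    + by rewrite in_itv/= leey andbT lee_fin (le_trans ler01).
    + exact: intK.
  rewrite poweR_EFin lee_fin ler_powR// lef_pV2 ?posrE//.
  exact: ltW.
- by rewrite lee_fin lef_pV2 ?posrE ?(lt_le_trans c0) ?cpsi.
Qed.

(** On [A k] the growth [2 ^+ k] of the test function offsets the decay of the measure, so every
    piece contributes at least [e * mu E / 2] to a finite integral; this forces [mu E] to be 0. *)
Lemma assoc_level_null {d} {T : measurableType d} {R : realType}
  (mu : {measure set T -> \bar R}) (psi : R -> R) (a b c e : R) (g : T -> R)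
  (E : set T) :
  atomless mu -> 0 < a -> b < 1 -> 0 < c ->
  (forall p, a < p < b -> c <= psi p) -> in_assoc mu psi a b g ->
  measurable E -> (mu E < +oo)%E -> 0 < e -> (forall x, E x -> e <= `|g x|) ->
  mu E = 0%E.
Proof.
move=> atl a0 b1 c0 cpsi [mg gG] mE Ey e0 Eg.
have [A [mA AE tA muA]] := atomless_geometric_partition mu E atl mE Ey.
have [f [mf fA f0]] := measurable_step_function A (fun k => 2 ^+ k : R) mA tA.
have fG : inG mu psi a b f by exact: (inG_geometric_step mu psi a b c E A).
have [m m0 muE] : exists2 m : R, 0 <= m & mu E = m%:E.
  by exists (fine (mu E)); rewrite ?fine_ge0// fineK// ge0_fin_numE.
have mfg : measurable_fun setT (fun x => `|f x * g x|%:E).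
  apply/measurable_EFinP; apply: (measurableT_comp (@normr_measurable R setT)).
  exact: measurable_funM.
have fg0 x : (0 <= `|f x * g x|%:E)%E by rewrite lee_fin.
have mU : measurable (\bigcup_k A k) by exact: bigcup_measurable.
have piece k : ((e * m / 2)%:E <= \int[mu]_(x in A k) `|f x * g x|%:E)%E.
  apply: (@le_trans _ _ (\int[mu]_(x in A k) (cst ((2 ^+ k * e)%:E) x))%E).
    rewrite integral_cst// muA muE -!EFinM lee_fin.
    rewrite [leRHS](_ : _ = e * m / 2 * (2 ^+ k * 2^-1 ^+ k)); last first.
      by rewrite exprS; ring.
    by rewrite -exprMn mulfV// expr1n mulr1.
  apply: ge0_le_integral => //.
  - by move=> x _; rewrite lee_fin mulr_ge0 ?exprn_ge0// ltW.
  - exact: measurable_funTS.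
  - move=> x Ak; rewrite lee_fin normrM (fA k x Ak) ger0_norm ?exprn_ge0//.
    by rewrite ler_wpM2l ?exprn_ge0//; apply: Eg; exact: (AE k).
have bound n : ((n%:R * (e * m / 2))%:E <= \int[mu]_x `|f x * g x|%:E)%E.
  apply: (@le_trans _ _ (\int[mu]_(x in \bigcup_k A k) `|f x * g x|%:E)%E); last first.
    exact: ge0_subset_integral.
  rewrite ge0_integral_bigcup//; last exact: measurable_funTS.
  apply: le_trans (nneseries_lim_ge n _); last by move=> k _ _; exact: integral_ge0.
  apply: (@le_trans _ _ (\sum_(0 <= k < n) (e * m / 2)%:E)%E); last first.
    by apply: lee_sum => k _; exact: piece.
  by rewrite sumEFin big_const_nat iter_addr_0 subn0 mulr_natl.
have fin := gG f fG.
have : (\int[mu]_x `|f x * g x|%:E)%E \is a fin_num.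
  by rewrite ge0_fin_numE//; exact: integral_ge0.
move=> /fineK I_E; set I := fine _ in I_E.
rewrite muE; congr EFin; apply/eqP; rewrite eq_le m0 andbT leNgt; apply/negP => mp.
have q0 : 0 < e * m / 2 by rewrite divr_gt0// mulr_gt0.
have I0 : 0 <= I by apply: fine_ge0; exact: integral_ge0.
(* Enough pieces for their total contribution to exceed the integral [I]. *)
have := bound (Num.bound (I / (e * m / 2))).
rewrite -I_E lee_fin leNgt -ltr_pdivrMr// archi_boundP// divr_ge0//.
exact: ltW.
Qed.

(** By sigma-finiteness, the set where [g] is nonzero is covered by countably many sets of finite
    measure on each of which [|g|] is bounded below; each is null. *)
Lemma assoc_ae_eq0 {d} {T : measurableType d} {R : realType}
  (mu : {measure set T -> \bar R}) (psi : R -> R) (a b c : R) (g : T -> R) :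
  atomless mu -> sigma_finite setT mu -> 0 < a -> b < 1 -> 0 < c ->
  (forall p, a < p < b -> c <= psi p) -> in_assoc mu psi a b g ->
  {ae mu, forall x, g x = 0}.
Proof.
move=> atl [F UF FP] a0 b1 c0 cpsi gA; have [mg _] := gA.
pose G n := [set x | n.+1%:R^-1 <= `|g x|].
have mG n : measurable (G n).
  have -> : G n = setT `&` (fun x => `|g x|) @^-1` `[n.+1%:R^-1, +oo[%classic.
    by rewrite setTI; apply/seteqP; split => x /=; rewrite in_itv/= andbT.
  exact: (measurableT_comp (@normr_measurable R setT) mg).
have null : mu.-negligible (\bigcup_i \bigcup_n (F i `&` G n)).
  apply: negligible_bigcup => i; apply: negligible_bigcup => n.
  have [mF Fy] := FP i.
  apply/negligibleP; first exact: measurableI.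
  apply: (assoc_level_null mu psi a b c n.+1%:R^-1 g _ atl a0 b1 c0 cpsi gA).
  - exact: measurableI.
  - apply: le_lt_trans Fy; apply: le_measure; rewrite ?inE//.
    exact: measurableI.
  - by rewrite invr_gt0.
  - by move=> x [].
apply: negligibleS null => x /= /eqP gx0.
have [i _ Fi] : (\bigcup_i F i) x by rewrite -UF.
have gx : 0 < `|g x| by rewrite normr_gt0.
exists i => //; exists (Num.bound `|g x|^-1) => //; split => //=.
rewrite /G/= invf_ple ?posrE// ltW// (@lt_trans _ _ (Num.bound `|g x|^-1)%:R) ?ltr_nat//.
by apply: archi_boundP; rewrite invr_ge0.
Qed.

Theorem theorem5p1 (d : measure_display) (T : measurableType d) (R : realType)
  (mu : {measure set T -> \bar R})
  (Hnontriv : (0 < mu setT)%E) (Hatomless : atomless mu)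
  (Hsigma : sigma_finite setT mu)
  (a b : R) (Ha : 0 < a) (Hab : a < b) (Hb : b < 1)
  (psi : R -> R) (Hpsi_pos : forall p, a < p < b -> 0 < psi p)
  (Hpsi_cont : {within `]a, b[%classic, continuous psi})
  (Hpsi_inf : exists2 c : R, 0 < c & forall p, a < p < b -> c <= psi p) :
  (forall L : (T -> R) -> R, in_dual mu psi a b L ->
     forall f, inG mu psi a b f -> L f = 0) /\
  (forall g : T -> R, in_assoc mu psi a b g -> {ae mu, forall x, g x = 0}).
Proof.
have [c c0 cpsi] := Hpsi_inf.
split=> [L LG f fG|g gA].
  exact: (dual_eq0 mu psi a b L f Hatomless Ha Hab Hb Hpsi_pos LG fG).
exact: (assoc_ae_eq0 mu psi a b c g Hatomless Hsigma Ha Hb c0 cpsi gA).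
Qed.
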